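(* Let $(\mathcal{B},\mathcal{L},\theta,\mathcal{I}_\alpha)$ be a generalized Boolean dynamical system. Let $E^0=X_\emptyset$, $F^0=X_\emptyset\cup\{\emptyset\}$ and $E^1=\{e^\alpha_\eta:\alpha\in\mathcal{L},\ \eta\in X_\alpha\}$ with the topologies described in the context. If we define maps $d:E^1\to E^0$ and $r:E^1\to F^0$ by $$d(e^\alpha_\eta)=h_{[\alpha]\emptyset}(\eta)=\{B\in\mathcal{B}:A\subseteq B\text{ for some }A\in\eta\},\qquad r(e^\alpha_\eta)=f_{\emptyset[\alpha]}(\eta)=\{A\in\mathcal{B}:\theta_\alpha(A)\in\eta\},$$ then $(E^1,d,r)$ is a topological correspondence from $E^0$ to $F^0$.
   Context: A Boolean algebra $\mathcal{B}$ is a (not necessarily unital) relatively complemented distributive lattice with least element $\emptyset$ and operations $\cap,\cup,\setminus$; $A\subseteq B$ means $A\cap B=A$. An ideal is a non-empty subset closed under finite unions and under intersection with arbitrary elements of $\mathcal{B}$. An action is a map $\mathcal{B}\to\mathcal{B}$ preserving $\cap,\cup,\setminus$ and $\emptyset$. A generalized Boolean dynamical system $(\mathcal{B},\mathcal{L},\theta,\mathcal{I}_\alpha)$ consists of a Boolean algebra $\mathcal{B}$, a set $\mathcal{L}$, actions $\{\theta_\alpha\}_{\alpha\in\mathcal{L}}$ and ideals $\{\mathcal{I}_\alpha\}_{\alpha\in\mathcal{L}}$ with $\{A\in\mathcal{B}:A\subseteq\theta_\alpha(B)\text{ for some }B\in\mathcal{B}\}\subseteq\mathcal{I}_\alpha$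 for all $\alpha\in\mathcal{L}$. A filter in a Boolean algebra is a non-empty, upward closed subset closed under finite intersections and not containing $\emptyset$; an ultrafilter is a maximal filter. $X_\emptyset$ is the set of ultrafilters in $\mathcal{B}$ with topology generated by $Z(A)=\{\xi\in X_\emptyset:A\in\xi\}$, $A\in\mathcal{B}$. For $\alpha\in\mathcal{L}$, $X_\alpha$ is the set of ultrafilters in the Boolean algebra $\mathcal{I}_\alpha$ with topology generated by $\{\eta\in X_\alpha:A\in\eta\}$, $A\in\mathcal{I}_\alpha$. $F^0=X_\emptyset\cup\{\emptyset\}$, where $\emptyset$ denotes the empty set as an additional point: if $\mathcal{B}$ is unital, $\emptyset$ is an isolated point; if $\mathcal{B}$ is not unital, $F^0$ is the one-point compactification of $X_\emptyset$ with $\emptyset$ as point at infinity. $E^1$ has the topology generated by the sets $Z^1(\alpha,B)=\{e^\alpha_\eta:\eta\in X_\alpha,B\in\eta\}$, $\alpha\in\mathcal{L}$, $B\in\mathcal{I}_\alpha$ (so $E^1$ is the topological disjoint union $\bigsqcup_{\alpha\in\mathcal{L}}X_\alpha$). $(E^1,d,r)$ being a topological correspondence from $E^0$ to $F^0$ means: $E^0,F^0,E^1$ are locally compact Hausdorff spaces, $d:E^1\to E^0$ is a (well-defined) local homeomorphism, and $r:E^1\to F^0$ is a (well-defined) continuous map. *)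

(* Defs.v *)
From HB Require Import structures.
From mathcomp Require Import all_boot all_order.
From mathcomp Require Import all_classical.
From mathcomp Require Import topology.

Set Implicit Arguments.
Unset Strict Implicit.
Unset Printing Implicit Defensive.

Local Open Scope classical_set_scope.

(* A (not necessarily unital) Boolean algebra is a [cbDistrLatticeType]: a
   distributive lattice with bottom and relative complement [`\`]. *)

Section BooleanAlgebra.
Context {disp : Order.disp_t} (B : cbDistrLatticeType disp).

Definition unital : Prop := exists u : B, forall A : B, (A <= u)%O.

Definition boolean_ideal (I : set B) : Prop :=
  [/\ I !=set0,
      forall A C, I A -> I C -> I (A `|` C)%O
    & forall A C, I A -> I (A `&` C)%O].

Definition boolean_action (f : B -> B) : Prop :=
  [/\ {morph f : A C / (A `&` C)%O},
      {morph f : A C / (A `|` C)%O},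
      {morph f : A C / (A `\` C)%O}
    & f \bot%O = \bot%O].

Definition generalized_Boolean_dynamical_system (L : Type)
    (theta : L -> B -> B) (I : L -> set B) : Prop :=
  [/\ forall a, boolean_action (theta a),
      forall a, boolean_ideal (I a)
    & forall a, [set A | exists C, (A <= theta a C)%O] `<=` I a].

(* Filters in a Boolean algebra D that is given as an ideal of B; B itself is
   [setT].  They are subsets of B contained in D. *)
Definition boolean_filter (D F : set B) : Prop :=
  [/\ F `<=` D /\ F !=set0,
      forall A C, F A -> D C -> (A <= C)%O -> F C,
      forall A C, F A -> F C -> F (A `&` C)%O
    & ~ F \bot%O].

Definition boolean_ultrafilter (D F : set B) : Prop :=
  boolean_filter D F /\
  forall G, boolean_filter D G -> F `<=` G -> G = F.

Record ultrafilters (D : set B) := Ultrafilter {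
  ultra_set :> set B;
  ultra_setP : boolean_ultrafilter D ultra_set }.

End BooleanAlgebra.

Section UltrafilterSpace.
Context {disp : Order.disp_t} {B : cbDistrLatticeType disp} (D : set B).

Definition Zset (A : B) : set (ultrafilters D) :=
  [set xi : ultrafilters D | (xi : set B) A].

HB.instance Definition _ := gen_eqMixin (ultrafilters D).
HB.instance Definition _ := gen_choiceMixin (ultrafilters D).
HB.instance Definition _ :=
  @isSubBaseTopological.Build (ultrafilters D) (set (ultrafilters D))
    (Zset @` D) id.

End UltrafilterSpace.

Section Spaces.
Context {disp : Order.disp_t} (B : cbDistrLatticeType disp).

Definition X0 : topologicalType := ultrafilters [set: B].

Definition F0 : Type := option (ultrafilters [set: B]).

Definition F0_set (x : F0) : set B :=
  if x is Some xi then (xi : set B) else set0.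

(* If B is unital, [None] is an isolated point next to X0; otherwise F0 is the
   one-point compactification of X0. *)
Definition F0_open (U : set F0) : Prop :=
  (unital B -> @open X0 (Some @^-1` U)) /\
  (~ unital B -> @open (one_point_compactification X0) U).

Let F0_openT : F0_open setT.
Proof. by split=> _; [rewrite preimage_setT|]; exact: openT. Qed.

Let F0_openI : setI_closed F0_open.
Proof.
move=> U V [U1 U2] [V1 V2]; split=> h.
  by rewrite preimage_setI; apply: openI; [exact: U1|exact: V1].
by apply: openI; [exact: U2|exact: V2].
Qed.

Let F0_open_bigU (J : Type) (f : J -> set F0) :
  (forall j, F0_open (f j)) -> F0_open (\bigcup_j f j).
Proof.
move=> fo; split=> h.
  by rewrite preimage_bigcup; apply: bigcup_open => j _; exact: (fo j).1.
by apply: bigcup_open => j _; exact: (fo j).2.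
Qed.

HB.instance Definition _ := Choice.on F0.
HB.instance Definition _ :=
  isOpenTopological.Build F0 F0_openT F0_openI F0_open_bigU.

Context {L : Type} (I : L -> set B).

Record E1 := Edge {
  edge_label : L;
  edge_ultra : ultrafilters (I edge_label) }.

Definition Z1 (a : L) (A : B) : set E1 := @Edge a @` @Zset disp B (I a) A.

HB.instance Definition _ := gen_eqMixin E1.
HB.instance Definition _ := gen_choiceMixin E1.
HB.instance Definition _ :=
  @isSubBaseTopological.Build E1 (set E1)
    [set Z | exists a A, I a A /\ Z = Z1 a A] id.

End Spaces.

Section Maps.
Context {disp : Order.disp_t} {B : cbDistrLatticeType disp}.

Definition h_map (eta : set B) : set B :=
  [set C | exists2 A, eta A & (A <= C)%O].

Definition f_map (t : B -> B) (eta : set B) : set B := [set A | eta (t A)].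

End Maps.

Section Correspondence.

Definition local_homeomorphism (X Y : topologicalType) (f : X -> Y) : Prop :=
  forall x, exists U : set X,
    [/\ open U, U x, open (f @` U)
      & exists g : Y -> X,
          [/\ forall z, U z -> g (f z) = z,
              {within U, continuous f}
            & {within f @` U, continuous g}]].

Definition locally_compact_Hausdorff (X : topologicalType) : Prop :=
  locally_compact [set: X] /\ hausdorff_space X.

Record topological_correspondence (E0 F0 E1 : topologicalType)
    (d : E1 -> E0) (r : E1 -> F0) : Prop := TopologicalCorrespondence {
  tc_E0 : locally_compact_Hausdorff E0;
  tc_F0 : locally_compact_Hausdorff F0;
  tc_E1 : locally_compact_Hausdorff E1;
  tc_d : local_homeomorphism d;
  tc_r : continuous r }.

End Correspondence.

(* Main.v *)
(* In an ideal D, a filter F is an ultrafilter iff for A in F and C in D it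
   contains A /\ C or A \ C.  This splitting property transfers the ultrafilter
   condition along h_map, along intersection with an ideal, and along preimages
   under actions.  The sets Zset A form a base of compact open sets, and so do the
   sets Z1 a A.  The map d is a homeomorphism from Z1 a A onto Zset A, with
   inverse y |-> I_a /\ y.  Every neighbourhood of None in F0 contains the
   complement of some Zset A (take A = 1 if B is unital), which gives the
   compactness of F0 and the continuity of r at edges mapped to None. *)
Require Import Defs.
From mathcomp Require Import all_boot all_order.
From mathcomp Require Import all_classical.
From mathcomp Require Import topology.

Set Implicit Arguments.
Unset Strict Implicit.
Unset Printing Implicit Defensive.

Import Order.LTheory Order.CTheory.

Local Open Scope classical_set_scope.

(** * Subbases, compact neighbourhoods and separation in general spaces *)

Section Topology.
Context {T : topologicalType}.

Lemma subbase_open (S : set (set T)) :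
  @open T = [set \bigcup_(i in D') i | D' in subset^~ (finI_from S id)] ->
  S `<=` open.
Proof.
move=> -> A SA; exists [set A]; last exact: bigcup_set1.
by move=> _ ->; exact: (@finI_from1 _ _ _ id).
Qed.

(** Every neighbourhood contains a finite intersection of subbasic sets around [x], and [F] is
    closed under such intersections. The hypothesis on [open] holds by definition for a topology
    built from a subbase. *)
Lemma subbase_cvg (S : set (set T)) :
  @open T = [set \bigcup_(i in D') i | D' in subset^~ (finI_from S id)] ->
  forall (x : T) (F : set_system T), Filter F ->
  (forall A, S A -> A x -> F A) -> F --> x.
Proof.
move=> openT x F FF SF V /=; rewrite nbhsE => -[U [+ Ux] UV].
rewrite openT => -[D' D'S UE]; rewrite -UE in Ux UV.
case: Ux => W D'W Wx; have [E ES WE] := D'S _ D'W.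
apply: (@filterS _ _ _ W); first by move=> y Wy; apply: UV; exists W.
rewrite -WE; apply: filter_bigI => A EA; apply: SF.
  by have := ES _ EA; rewrite inE.
by move: Wx; rewrite -WE; exact.
Qed.

Lemma locally_compact_nbhs : hausdorff_space T ->
  (forall x : T, exists2 K, compact K & nbhs x K) -> locally_compact [set: T].
Proof.
move=> hT cT x _; have [K cK xK] := cT x.
exists K; first by apply: filterS xK => y Ky _.
by split=> //; exact: compact_closed.
Qed.

Lemma separated_hausdorff :
  (forall x y : T, x <> y ->
    exists U V, [/\ nbhs x U, nbhs y V & U `&` V = set0]) -> hausdorff_space T.
Proof.
move=> sep x y xy; apply: contrapT => /sep[U [V [xU yV UV0]]].
by have := xy _ _ xU yV; rewrite UV0 => -[].
Qed.

End Topology.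

(** * Ultrafilters in an ideal and their Stone topology *)

Section Ultrafilters.
Context {disp : Order.disp_t} {B : cbDistrLatticeType disp}.
Implicit Types (D F xi : set B) (A C : B).

Lemma ideal_le D A C : boolean_ideal D -> D C -> (A <= C)%O -> D A.
Proof. by move=> [_ _ DI] DC /meet_r <-; exact: DI. Qed.

Lemma ideal_setT : boolean_ideal [set: B].
Proof. by split => //; exists \bot%O. Qed.

(** If [A /\ C] is not in [xi], then [xi] and [A \ C] generate a filter [G]: an [F] in [xi] disjoint
    from [A \ C] would satisfy [F /\ A <= C] and so force [A /\ C] into [xi]. Maximality gives
    [G = xi]. *)
Lemma ultrafilter_split D xi A C : boolean_ideal D ->
  boolean_ultrafilter D xi -> xi A -> xi (A `&` C)%O \/ xi (A `\` C)%O.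
Proof.
move=> Di [[[xiD xi0] xiU xiI xibot] ximax] xiA.
have [|xiAC] := pselect (xi (A `&` C)%O); first by left.
right; pose G := [set E | D E /\ exists2 F, xi F & (F `&` (A `\` C) <= E)%O].
have DAC : D (A `\` C)%O by apply: (ideal_le Di (xiD _ xiA)); exact: leBx.
suff <- : G = xi by split => //; exists A => //; exact: leIr.
apply: ximax => [|F xiF]; last first.
  by split; [exact: xiD|exists F => //; exact: leIl].
split.
- split; first by move=> E [].
  by exists A; split; [exact: xiD|exists A => //; exact: leIl].
- move=> E E' [DE [F xiF FE]] DE' EE'; split => //; exists F => //.
  exact: le_trans EE'.
- move=> E E' [DE [F xiF FE]] [DE' [F' xiF' FE']]; split.
    by apply: (ideal_le Di DE); exact: leIl.
  exists (F `&` F')%O; first exact: xiI.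
  rewrite lexI (le_trans _ FE) ?(le_trans _ FE')// leI2//.
    exact: leIr.
  exact: leIl.
- move=> [_ [F xiF]]; rewrite lex0 meetxB diff_eq0 => FAC.
  apply: xiAC; apply: xiU (xiI _ _ xiF xiA) _ _.
    by apply: (ideal_le Di (xiD _ xiA)); exact: leIl.
  by rewrite lexI leIr.
Qed.

(** Let [C] lie in a larger filter [G], and take [A] in [F]. Having [A \ C] in [F] would put its
    meet with [C], which is bottom, into [G]; so [A /\ C], and hence [C], lies in [F]. *)
Lemma split_ultrafilter D F : boolean_filter D F ->
  (forall A C, F A -> D C -> F (A `&` C)%O \/ F (A `\` C)%O) ->
  boolean_ultrafilter D F.
Proof.
move=> FD Fsplit; split=> // G [[GD _] _ GI Gbot] FG.
apply/seteqP; split=> // C GC; case: FD => -[FD [A FA]] FU FI Fbot.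
have [FAC|FAC] := Fsplit A C FA (GD _ GC).
  by apply: FU FAC (GD _ GC) _; exact: leIr.
by exfalso; apply: Gbot; rewrite -(diffKI A C); apply: GI => //; exact: FG.
Qed.

Lemma ultrafilters_inj D : injective (@ultra_set disp B D).
Proof.
move=> [x xP] [y yP] /= xy; case: _ / xy yP => yP.
by rewrite (Prop_irrelevance xP yP).
Qed.

Context (D : set B) (Di : boolean_ideal D).
Implicit Types x y : ultrafilters D.
Local Notation Z := (@Zset disp B D).

Lemma ultra_sub x A : ultra_set x A -> D A.
Proof. by case: x => /= xi [[[+ _] _ _ _] _]; exact. Qed.

Lemma ultra_ex x : exists A, ultra_set x A.
Proof. by case: x => /= xi [[[_ +] _ _ _] _]. Qed.

Lemma ultra_up x A C : ultra_set x A -> D C -> (A <= C)%O -> ultra_set x C.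
Proof. by case: x => /= xi [[_ + _ _] _]; exact. Qed.

Lemma ultraI x A C : ultra_set x A -> ultra_set x C -> ultra_set x (A `&` C)%O.
Proof. by case: x => /= xi [[_ _ + _] _]; exact. Qed.

Lemma ultra_bot x : ~ ultra_set x \bot%O.
Proof. by case: x => /= xi [[_ _ _ +] _]. Qed.

Lemma ultra_split x A C :
  ultra_set x A -> ultra_set x (A `&` C)%O \/ ultra_set x (A `\` C)%O.
Proof. exact: ultrafilter_split Di (ultra_setP x). Qed.

(** Maximality of [x] provides [A] in [x] but not in [y]; splitting any [C] of [y] along [A] then
    leaves [C \ A] in [y]. *)
Lemma ultra_separated x y : x <> y ->
  exists A C, [/\ ultra_set x A, ultra_set y C & (A `&` C)%O = \bot%O].
Proof.
move=> xy; have [A xA yA] : exists2 A, ultra_set x A & ~ ultra_set y A.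
  apply: contrapT => nA; apply: xy; apply: ultrafilters_inj.
  apply/esym; have [_] := ultra_setP x; apply; first by have [] := ultra_setP y.
  by move=> A xA; apply: contrapT => yA; apply: nA; exists A.
have [C yC] := ultra_ex y; exists A, (C `\` A)%O; rewrite diffKI; split => //.
have [yCA|//] := ultra_split A yC; exfalso; apply: yA.
by apply: ultra_up yCA (ultra_sub xA) _; exact: leIr.
Qed.

Lemma Zset_base x V :
  nbhs x V <-> exists2 A, ultra_set x A & Z A `<=` V.
Proof.
have Zfilter : Filter (filter_from (ultra_set x) (Z)).
  apply: filter_from_filter; first exact: ultra_ex.
  move=> A C xA xC; exists (A `&` C)%O; first exact: ultraI.
  move=> y yAC; split.
    by apply: ultra_up yAC (ultra_sub xA) _; exact: leIl.
  by apply: ultra_up yAC (ultra_sub xC) _; exact: leIr.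
split=> [xV|[A xA AV]].
  suff /(_ V xV) : filter_from (ultra_set x) Z --> x by [].
  apply: (@subbase_cvg _ (Z @` D)) => // _ [A _ <-] xA.
  by exists A.
apply: (filterS AV); apply: open_nbhs_nbhs; split=> //.
apply: (@subbase_open _ (Z @` D)) => //.
by exists A => //; exact: ultra_sub xA.
Qed.

Lemma Zset_open A : open (Z A).
Proof. by rewrite openE => x xA; apply/Zset_base; exists A. Qed.

Lemma Zset_nbhs x A : ultra_set x A -> nbhs x (Z A).
Proof. by move=> xA; apply/Zset_base; exists A. Qed.

(* An ultrafilter [F] of sets on [Z A] converges to [{C | F (Z C)}]. *)
Lemma Zset_compact A : compact (Z A).
Proof.
rewrite compact_ultra => F UF FA /=.
have [x0 x0A] := filter_ex FA.
pose xi : set B := [set C | D C /\ F (Z C)].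
have xi_filter : boolean_filter D xi.
  split.
  - by split=> [C []//|]; exists A; split => //; exact: ultra_sub x0A.
  - move=> C E [DC FC] DE CE; split=> //; apply: filterS FC => x xC.
    exact: ultra_up xC DE CE.
  - move=> C E [DC FC] [DE FE]; split; first exact: ideal_le Di DC (leIl _ _).
    by apply: filterS2 FC FE => x; exact: ultraI.
  - by case=> _ /filter_ex[x /ultra_bot].
have xi_ultra : boolean_ultrafilter D xi.
  apply: split_ultrafilter xi_filter _ => C E [DC FC] DE.
  have DCE A' : (A' <= C)%O -> D A' by exact: ideal_le.
  (* The dichotomy of [F] at [Z E] becomes the splitting of [xi] at [E]: a point of [Z C] outside
     [Z E] contains [C \ E]. *)
  have [FE|FE] := in_ultra_setVsetC (Z E) UF.
    left; split; first exact: DCE (leIl _ _).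
    by apply: filterS2 FC FE => x; exact: ultraI.
  right; split; first exact: DCE (leBx _ _).
  apply: filterS2 FC FE => x xC xE.
  have [xCE|//] := ultra_split E xC; exfalso; apply: xE.
  by apply: ultra_up xCE DE _; exact: leIr.
exists (Ultrafilter xi_ultra); split.
  by split => //; exact: ultra_sub x0A.
by move=> V /Zset_base[C [_ FC] CV]; exact: filterS FC.
Qed.

Lemma ultrafilters_hausdorff : hausdorff_space (ultrafilters D).
Proof.
apply: separated_hausdorff => x y /ultra_separated[A [C [xA yC AC0]]].
exists (Z A), (Z C); split; [exact: Zset_nbhs..|].
by apply/seteqP; split=> // z [zA zC]; apply: (@ultra_bot z); rewrite -AC0; exact: ultraI.
Qed.

Lemma ultrafilters_lcH : locally_compact_Hausdorff (ultrafilters D).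
Proof.
split; last exact: ultrafilters_hausdorff.
apply: locally_compact_nbhs ultrafilters_hausdorff _ => x.
have [A xA] := ultra_ex x; exists (Z A); first exact: Zset_compact.
exact: Zset_nbhs.
Qed.

End Ultrafilters.

(** * The space [F0]: neighbourhoods, separation and compactness *)

Section OnePointSpace.
Context {disp : Order.disp_t} {B : cbDistrLatticeType disp}.
Local Notation Z := (@Zset disp B [set: B]).
Let BT : boolean_ideal [set: B] := ideal_setT.

(** Otherwise the nonempty sets [K] minus [Z A], directed through joins of the [A], generate a
    proper filter. A cluster point [x] in [K] contains some [A], but [Z A] is then a neighbourhood
    of [x] missing one of these sets. *)
Lemma compact_sub_Zset (K : set (X0 B)) : compact K -> exists A, K `<=` Z A.
Proof.
move=> cK; apply: contrapT => nK.
have [||x [_ xK]] := cK (filter_from [set: B] (fun A => K `\` Z A)).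
- apply: filter_from_proper => [|A _].
    apply: filter_from_filter; first by exists \bot%O.
    move=> A C _ _; exists (A `|` C)%O => // x [Kx xAC].
    by split; split=> // xA; apply: xAC; apply: (ultra_up xA) => //;
      [exact: leUl|exact: leUr].
  apply: contrapT => /nonemptyPn/eqP KA; apply: nK; exists A.
  by rewrite -setD_eq0; exact/eqP.
- by exists \bot%O => // x [].
- have [A xA] := ultra_ex x.
  have [|y [[_ nyA] yA]] := xK (K `\` Z A) (Z A) _ (Zset_nbhs xA).
    by exists A.
  exact: nyA yA.
Qed.

Lemma F0_open_image (U : set (X0 B)) : open U -> @open (F0 B) (Some @` U).
Proof.
move=> oU; split=> _; last exact: one_point_compactification_open_some.
by rewrite (_ : _ @^-1` _ = U)//; apply/seteqP; split=> [x [y Uy [<-]]|x Ux] //; exists x.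
Qed.

Lemma F0_open_setC (K : set (X0 B)) : compact K ->
  @open (F0 B) (~` (Some @` K)).
Proof.
move=> cK; have clK : closed K.
  by apply: compact_closed cK; exact: ultrafilters_hausdorff.
split=> _.
  rewrite (_ : _ @^-1` _ = ~` K); first exact: closed_openC.
  apply/seteqP; split=> x Kx; first by move=> Kx'; apply: Kx; exists x.
  by case=> y + [yx]; rewrite yx.
rewrite openE => -[x Kx|_]; last first.
  exists K => // -[x|]; last by move=> _ [].
  by case=> // -[y nKy [<-]] [z Kz [zy]]; apply: nKy; rewrite -zy.
apply: (@filterS _ _ _ (~` K)).
  by move=> y nKy [z Kz [zy]]; apply: nKy; rewrite -zy.
by apply: open_nbhs_nbhs; split; [exact: closed_openC|move=> Kx'; apply: Kx; exists x].
Qed.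

Lemma nbhs_F0_Some (x : X0 B) (U : set (F0 B)) :
  nbhs (Some x : F0 B) U <-> exists2 A, ultra_set x A & Some @` Z A `<=` U.
Proof.
split=> [|[A xA AU]]; last first.
  apply: (filterS AU); apply: open_nbhs_nbhs; split; last by exists x.
  by apply: F0_open_image; exact: Zset_open.
rewrite nbhsE => -[V [[uV nV] Vx] VU].
suff /Zset_base[A xA AV] : nbhs x (Some @^-1` V).
  by exists A => // _ [y yA <-]; apply: VU; exact: AV.
have [/uV oV|/nV oV] := pselect (unital B).
  exact: open_nbhs_nbhs.
(* By definition of the compactification, the neighbourhoods of [Some x] are the sets whose preimage
   under [Some] is a neighbourhood of [x]. *)
by have : @nbhs _ (one_point_compactification (X0 B)) (Some x) V by exact: open_nbhs_nbhs.
Qed.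

Lemma nbhs_F0_None (U : set (F0 B)) :
  nbhs (None : F0 B) U <-> exists A, ~` (Some @` Z A) `<=` U.
Proof.
split=> [|[A AU]]; last first.
  apply: (filterS AU); apply: open_nbhs_nbhs; split; last by case.
  by apply: F0_open_setC; exact: Zset_compact.
rewrite nbhsE => -[V [[uV nV] Vx] VU].
have [[u uT]|nu] := pselect (unital B).
  exists u => -[x xu|_]; last exact: VU.
  exfalso; apply: xu; exists x => //; have [A xA] := ultra_ex x.
  exact: ultra_up xA _ (uT A).
have : @nbhs _ (one_point_compactification (X0 B)) None V.
  by apply: open_nbhs_nbhs; split => //; exact: nV.
case=> K [cK _] KV; have [A KA] := compact_sub_Zset cK.
exists A => -[x xA|_]; last exact: VU.
by apply: VU; apply: KV; left; exists x => // Kx; apply: xA; exists x => //; exact: KA.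
Qed.

Lemma F0_hausdorff : hausdorff_space (F0 B).
Proof.
have sepN (x : X0 B) : exists2 A, ultra_set x A & nbhs (None : F0 B) (~` (Some @` Z A)).
  by have [A xA] := ultra_ex x; exists A => //; apply/nbhs_F0_None; exists A.
apply: separated_hausdorff => -[x|] [y|] // xy.
- have /(ultra_separated BT)[A [C [xA yC AC0]]] : x <> y.
    by move=> E; apply: xy; rewrite E.
  exists (Some @` Z A), (Some @` Z C); split.
  + by apply/nbhs_F0_Some; exists A.
  + by apply/nbhs_F0_Some; exists C.
  + apply/seteqP; split=> // _ [[z zA <-] [z' zC [zz']]].
    rewrite zz' in zC; apply: (@ultra_bot _ _ _ z); rewrite -AC0; exact: ultraI.
- have [A xA NA] := sepN x; exists (Some @` Z A), (~` (Some @` Z A)).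
  by rewrite setICr; split => //; apply/nbhs_F0_Some; exists A.
- have [A xA NA] := sepN y; exists (~` (Some @` Z A)), (Some @` Z A).
  by rewrite setICl; split => //; apply/nbhs_F0_Some; exists A.
Qed.

Lemma F0_Some_continuous : continuous (Some : X0 B -> F0 B).
Proof.
move=> x U /nbhs_F0_Some[A xA AU]; apply/Zset_base; exists A => // y yA.
by apply: AU; exists y.
Qed.

Lemma F0_compact : compact [set: F0 B].
Proof.
rewrite compact_ultra => F UF _ /=.
have [[A FA]|nF] := pselect (exists A, F (Some @` Z A)).
  have := @continuous_compact _ _ (Some : X0 B -> F0 B) (Z A)
    (continuous_subspaceT F0_Some_continuous) (Zset_compact BT (A:=A)).
  by rewrite compact_ultra => /(_ F UF FA)[p [_ Fp]]; exists p.
exists None; split => // U /nbhs_F0_None[A AU].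
apply: filterS AU _; have [FA|//] := in_ultra_setVsetC (Some @` Z A) UF.
by exfalso; apply: nF; exists A.
Qed.

Lemma F0_lcH : locally_compact_Hausdorff (F0 B).
Proof.
split; last exact: F0_hausdorff.
apply: locally_compact_nbhs F0_hausdorff _ => x; exists setT; first exact: F0_compact.
exact: filterT.
Qed.

End OnePointSpace.

(** * The edge space as a disjoint union over the labels *)

Section EdgeSpace.
Context {disp : Order.disp_t} {B : cbDistrLatticeType disp} {L : Type}.
Context (I : L -> set B) (Ii : forall a, boolean_ideal (I a)).
Implicit Types (e : E1 I) (a : L) (A C : B).
Local Notation Z := (@Z1 disp B L I).

Lemma Z1E a A e :
  Z a A e <-> edge_label e = a /\ ultra_set (edge_ultra e) A.
Proof.
split=> [[eta etaA <-]//|]; case: e => b eta /= [ba etaA].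
by subst b; exists eta.
Qed.

Lemma Z1_base e V :
  nbhs e V <->
  exists2 A, ultra_set (edge_ultra e) A & Z (edge_label e) A `<=` V.
Proof.
case: e => a eta /=.
pose S : set (set (E1 I)) := [set W | exists b A, I b A /\ W = Z b A].
have Zfilter : Filter (filter_from (ultra_set eta) (Z a)).
  apply: filter_from_filter; first exact: ultra_ex.
  move=> A C eA eC; exists (A `&` C)%O; first exact: ultraI.
  move=> _ [y yAC <-]; split; exists y => //.
    by apply: ultra_up yAC (ultra_sub eA) _; exact: leIl.
  by apply: ultra_up yAC (ultra_sub eC) _; exact: leIr.
split=> [eV|[A eA AV]].
  suff /(_ V eV) : filter_from (ultra_set eta) (Z a) --> Edge eta by [].
  (* A subbasic set around the edge must carry its label, so only sets [Z a A] with [A] in [eta]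
     have to be tested. *)
  apply: (@subbase_cvg _ S) => // _ [b [A [_ ->]]] /Z1E[/= <- etaA].
  by exists A.
apply: (filterS AV); apply: open_nbhs_nbhs; split; last by exists eta.
apply: (@subbase_open _ S) => //.
by exists a, A; split => //; exact: ultra_sub eA.
Qed.

Lemma Z1_open a A : open (Z a A).
Proof. by rewrite openE => e /Z1E[<- eA]; apply/Z1_base; exists A. Qed.

Lemma Edge_continuous a : continuous (@Edge _ _ _ I a).
Proof.
move=> eta V /Z1_base[A etaA AV]; apply/Zset_base.
by exists A => // y yA; apply: AV; exists y.
Qed.

Lemma Z1_compact a A : compact (Z a A).
Proof.
apply: continuous_compact; last exact: Zset_compact.
by apply: continuous_subspaceT; exact: Edge_continuous.
Qed.

Lemma E1_hausdorff : hausdorff_space (E1 I).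
Proof.
apply: separated_hausdorff => -[a x] [b y] xy.
suff [A [C [xA yC AC0]]] : exists A C, [/\ ultra_set x A, ultra_set y C
    & Z a A `&` Z b C = set0].
  by exists (Z a A), (Z b C); split => //; apply/Z1_base; [exists A|exists C].
(* Different labels make any two sets [Z a A] and [Z b C] disjoint; for equal labels, disjoint
   elements of the two ultrafilters are needed. *)
have [ab|ab] := pselect (a = b); last first.
  have [[A xA] [C yC]] := (ultra_ex x, ultra_ex y); exists A, C; split => //.
  by apply/seteqP; split=> // e [/Z1E[ea _] /Z1E[eb _]]; apply: ab; rewrite -ea.
subst b; have /(ultra_separated (Ii a))[A [C [xA yC AC0]]] : x <> y.
  by move=> E; apply: xy; rewrite E.
exists A, C; split => //; apply/seteqP; split=> // e [/Z1E[_ eA] /Z1E[_ eC]].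
by apply: (@ultra_bot _ _ _ (edge_ultra e)); rewrite -AC0; exact: ultraI.
Qed.

Lemma E1_lcH : locally_compact_Hausdorff (E1 I).
Proof.
split; last exact: E1_hausdorff.
apply: locally_compact_nbhs E1_hausdorff _ => e.
have [A eA] := ultra_ex (edge_ultra e).
exists (Z (edge_label e) A); first exact: Z1_compact.
by apply/Z1_base; exists A.
Qed.

End EdgeSpace.

(** * Transfer of ultrafilters between an ideal and the whole algebra *)

Section UltrafilterMaps.
Context {disp : Order.disp_t} {B : cbDistrLatticeType disp}.
Context (D : set B) (Di : boolean_ideal D).

Lemma h_map_ultra (x : ultrafilters D) :
  boolean_ultrafilter setT (h_map (ultra_set x)).
Proof.
apply: split_ultrafilter; first split.
- by split => //; have [A xA] := ultra_ex x; exists A, A.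
- by move=> A C [E xE EA] _ leAC; exists E => //; exact: le_trans EA leAC.
- move=> A C [E xE EA] [F xF FC]; exists (E `&` F)%O; first exact: ultraI.
  exact: leI2.
- by move=> [A xA]; rewrite lex0 => /eqP A0; apply: (@ultra_bot _ _ _ x); rewrite -A0.
- move=> A C [E xE EA] _; have [xEC|xEC] := ultra_split Di C xE.
    by left; exists (E `&` C)%O => //; exact: leI2.
  by right; exists (E `\` C)%O => //; exact: leBl.
Qed.

(** The element [A] keeps the intersection nonempty; the two pieces of a split element of [D] stay
    in [D], because they lie below it. *)
Lemma setI_ultra (y : X0 B) A : ultra_set y A -> D A ->
  boolean_ultrafilter D (D `&` ultra_set y).
Proof.
move=> yA DA; apply: split_ultrafilter; first split.
- by split; [exact: subIsetl|exists A].
- by move=> C E [DC yC] DE CE; split => //; exact: ultra_up yC _ CE.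
- move=> C E [DC yC] [DE yE]; split; last exact: ultraI.
  exact: ideal_le DC (leIl _ _).
- by case=> _ /ultra_bot.
- move=> C E [DC yC] DE; have [yCE|yCE] := ultra_split ideal_setT E yC.
    by left; split => //; exact: ideal_le DC (leIl _ _).
  by right; split => //; exact: ideal_le DC (leBx _ _).
Qed.

Lemma h_mapK (x : ultrafilters D) : D `&` h_map (ultra_set x) = ultra_set x.
Proof.
apply/seteqP; split=> [C [DC [A xA leAC]]|A xA].
  exact: ultra_up xA DC leAC.
by split; [exact: ultra_sub xA|exists A].
Qed.

Lemma setI_h_map (y : X0 B) A : ultra_set y A -> D A ->
  h_map (D `&` ultra_set y) = ultra_set y.
Proof.
move=> yA DA; apply/seteqP; split=> [C [E [_ yE] EC]|C yC].
  exact: ultra_up yE _ EC.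
exists (A `&` C)%O; last exact: leIr.
by split; [exact: ideal_le DA (leIl _ _)|exact: ultraI].
Qed.

(** As [t] commutes with meets and differences, splitting [t A] along [t C] in [x] splits [A] along
    [C] in the preimage. Nonemptiness is not automatic, hence its place among the hypotheses. *)
Lemma f_map_ultra (t : B -> B) (x : ultrafilters D) : boolean_action t ->
  (forall A, D (t A)) -> f_map t (ultra_set x) !=set0 ->
  boolean_ultrafilter setT (f_map t (ultra_set x)).
Proof.
move=> [tI tU tB t0] tD xt; apply: split_ultrafilter; first split => //.
- move=> A C xA _ leAC; apply: ultra_up xA (tD _) _.
  by rewrite -(meet_l leAC) tI leIr.
- by move=> A C xA xC; rewrite /f_map/= tI; exact: ultraI.
- by rewrite /f_map/= t0; exact: ultra_bot.
- by move=> A C xA _; rewrite /f_map/= tI tB; exact: ultra_split.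
Qed.

End UltrafilterMaps.

(** * The maps [d] and [r] and their topological properties *)

Section Correspondence.
Context {disp : Order.disp_t} {B : cbDistrLatticeType disp} {L : Type}.
Context (theta : L -> B -> B) (I : L -> set B).
Hypothesis sys : generalized_Boolean_dynamical_system theta I.

Let theta_action a : boolean_action (theta a).
Proof. by have [+ _ _] := sys; exact. Qed.

Let Ii a : boolean_ideal (I a).
Proof. by have [_ + _] := sys; exact. Qed.

Let I_theta a A : I a (theta a A).
Proof. by have [_ _ +] := sys; apply; exists A. Qed.

Definition domain_map (e : E1 I) : X0 B :=
  Ultrafilter (h_map_ultra (Ii (edge_label e)) (edge_ultra e)).

(** The preimage is either empty or an ultrafilter; the empty case goes to [None], whose [F0_set] is
    empty, so that [range_mapE] holds uniformly. *)
Definition range_map (e : E1 I) : F0 B :=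
  if pselect (f_map (theta (edge_label e)) (ultra_set (edge_ultra e)) !=set0)
    is left h
  then Some (Ultrafilter (f_map_ultra (Ii _) (theta_action _) (I_theta _) h))
  else None.

Lemma range_mapE e : F0_set (range_map e) =
  f_map (theta (edge_label e)) (ultra_set (edge_ultra e)).
Proof.
rewrite /range_map; case: pselect => //= /nonemptyPn.
by move=> ->.
Qed.

Lemma range_map_continuous : continuous range_map.
Proof.
move=> e U /=; case re : (range_map e) => [x|].
  move=> /nbhs_F0_Some[A xA AU]; apply/Z1_base.
  exists (theta (edge_label e) A).
    by rewrite -[ultra_set _ _]/(f_map _ _ A) -range_mapE re.
  move=> e' /Z1E[ee']; rewrite -ee' -[ultra_set _ _]/(f_map _ _ A) -range_mapE.
  by rewrite /preimage/=; case: (range_map e') => // y yA; apply: AU; exists y.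
move=> /nbhs_F0_None[A AU]; apply/Z1_base.
have eA : ~ ultra_set (edge_ultra e) (theta (edge_label e) A).
  by rewrite -[ultra_set _ _]/(f_map _ _ A) -range_mapE re.
have [C eC] := ultra_ex (edge_ultra e).
exists (C `\` theta (edge_label e) A)%O.
  have [eCA|//] := ultra_split (Ii _) (theta (edge_label e) A) eC.
  by exfalso; apply: eA; apply: ultra_up eCA (I_theta _ _) _; exact: leIr.
move=> e' /Z1E[ee']; rewrite -ee' => e'CA; apply: AU => -[y yA ye'].
have : F0_set (range_map e') A by rewrite -ye'.
rewrite range_mapE => e'A; apply: (@ultra_bot _ _ _ (edge_ultra e')).
by rewrite -(diffIK C (theta (edge_label e') A)); exact: ultraI.
Qed.

Lemma domain_map_continuous : continuous domain_map.
Proof.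
move=> e V /Zset_base[C [A eA leAC] CV]; apply/Z1_base.
by exists A => // e' /Z1E[_ e'A]; apply: CV; exists A.
Qed.

Lemma domain_map_local_homeomorphism : local_homeomorphism domain_map.
Proof.
move=> [a x]; have [A xA] := ultra_ex x; have IA := ultra_sub xA.
(* The local inverse intersects [y] with [I a]. Outside [Zset A] this may fail to be an ultrafilter,
   and [Edge x] is only a default value there. *)
pose g (y : X0 B) : E1 I :=
  if pselect (ultra_set y A) is left yA
  then Edge (Ultrafilter (setI_ultra (Ii a) yA IA)) else Edge x.
have gE (y : X0 B) C : ultra_set y A -> I a C -> ultra_set y C -> Z1 a C (g y).
  by move=> yA IC yC; rewrite /g; case: pselect => // yA'; apply/Z1E.
have dg (y : X0 B) : ultra_set y A -> domain_map (g y) = y.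
  move=> yA; apply: ultrafilters_inj; rewrite /g; case: pselect => //= yA'.
  by have := setI_h_map (Ii a) yA IA.
have dZ e : Z1 a A e -> ultra_set (domain_map e) A.
  by move=> /Z1E[_ eA]; exists A.
have dZE : domain_map @` Z1 a A = Zset A.
  apply/seteqP; split=> [_ [e eA <-]|y yA]; first exact: dZ.
  by exists (g y); [exact: gE|exact: dg].
exists (Z1 a A); split.
- exact: Z1_open.
- by exists x.
- by rewrite dZE; exact: Zset_open.
exists g; split.
- move=> _ [y yA <-]; rewrite /g; case: pselect => [yA'|[]]; last by exists A.
  by congr Edge; apply: ultrafilters_inj => /=; exact: h_mapK.
- exact: continuous_subspaceT domain_map_continuous.
- rewrite dZE; apply: continuous_in_subspaceT => y /set_mem yA V.
  move=> /Z1_base[C gyC CV]; apply/Zset_base.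
  have gya : edge_label (g y) = a by have /Z1E[] := gE y A yA IA yA.
  have IC : I a C by rewrite -gya; exact: ultra_sub gyC.
  have yC : ultra_set y C by rewrite -(dg y yA); exists C.
  (* Meeting [C] with [A] keeps [z] inside [Zset A], where [g] is given by intersection and not by
     its default. *)
  exists (A `&` C)%O; first exact: ultraI.
  move=> z zAC; apply: CV; rewrite gya; apply: gE => //.
    by apply: (ultra_up zAC) => //; exact: leIl.
  by apply: (ultra_up zAC) => //; exact: leIr.
Qed.

End Correspondence.

Theorem proposition7p1 (disp : Order.disp_t) (B : cbDistrLatticeType disp)
    (L : Type) (theta : L -> B -> B) (I : L -> set B)
    (sys : generalized_Boolean_dynamical_system theta I) :
  exists (d : E1 I -> X0 B) (r : E1 I -> F0 B),
    [/\ forall (a : L) (eta : ultrafilters (I a)),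
          ultra_set (d (Edge eta)) = h_map (ultra_set eta),
        forall (a : L) (eta : ultrafilters (I a)),
          F0_set (r (Edge eta)) = f_map (theta a) (ultra_set eta)
      & topological_correspondence d r].
Proof.
have Ii a : boolean_ideal (I a) by have [_ + _] := sys; exact.
exists (domain_map sys), (range_map sys); split=> [//|a eta|].
  exact: range_mapE.
split.
- exact: ultrafilters_lcH ideal_setT.
- exact: F0_lcH.
- exact: E1_lcH.
- exact: domain_map_local_homeomorphism.
- exact: range_map_continuous.
Qed.
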